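(* Let $m=2$ and $\alpha,\beta\in[-\pi,\pi]$ with $\alpha\notin\{0,\pm\pi\}$. The kernel of the fractional Clifford-Fourier transform in dimension $m=2$ is given, for all $\underline x,\underline y\in\mathbb R^2$, by $$K_{\alpha,\beta}(\underline x,\underline y)=e^{\frac i2(\cot\alpha)(|\underline x|^2+|\underline y|^2)}\,e^{i\beta\Gamma_{\underline y}}\left(e^{-i\langle\underline x,\underline y\rangle/\sin\alpha}\right)$$ $$=\left(\cos\left(t\,\frac{\sin\beta}{\sin\alpha}\right)+(\underline x\wedge\underline y)\,\frac{\sin\left(t\,\frac{\sin\beta}{\sin\alpha}\right)}{t}\right)e^{-i\langle\underline x,\underline y\rangle\frac{\cos\beta}{\sin\alpha}}\,e^{\frac i2(\cot\alpha)(|\underline x|^2+|\underline y|^2)},$$ with $t=|\underline x\wedge\underline y|=\sqrt{|\underline x|^2|\underline y|^2-\langle\underline x,\underline y\rangle^2}$ (the quotient by $t$ being understood by its limit when $t=0$).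
   Context: $\mathcal{C}l_{0,m}$ is the Clifford algebra generated by $e_1,\dots,e_m$ with $e_ie_j+e_je_i=0$ ($i\ne j$) and $e_i^2=-1$, with complex coefficients allowed; here $m=2$. Vectors are written $\underline x=\sum_jx_je_j$; $\langle\underline x,\underline y\rangle=\sum_jx_jy_j$, $\underline x\wedge\underline y=\sum_{j<k}e_je_k(x_jy_k-x_ky_j)$, and $\Gamma_{\underline y}=-\sum_{j<k}e_je_k(y_j\partial_{y_k}-y_k\partial_{y_j})$. The operator $e^{i\beta\Gamma_{\underline y}}$ acts in the variable $\underline y$ by the exponential series $\sum_{n\ge0}\frac{(i\beta)^n}{n!}\Gamma_{\underline y}^n$. The fractional Clifford-Fourier transform is $\mathcal F_{\alpha,\beta}=e^{\frac{i\alpha m}{2}}e^{i\beta\Gamma}e^{\frac{i\alpha}{2}(\Delta-|\underline x|^2)}$, written as $\mathcal F_{\alpha,\beta}[f](\underline y)=(\pi(1-e^{-2i\alpha}))^{-m/2}\int_{\mathbb R^m}K_{\alpha,\beta}(\underline x,\underline y)f(\underline x)\,dx$; its kernel is $K_{\alpha,\beta}(\underline x,\underline y)=e^{\frac i2(\cot\alpha)(|\underline x|^2+|\underline y|^2)}e^{i\beta\Gamma_{\underline y}}(e^{-i\langle\underline x,\underline y\rangle/\sin\alpha})$. *)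

(* Defs.v *)
From HB Require Import structures.
From mathcomp Require Import all_boot all_order all_algebra.
From mathcomp Require Import ring complex.
From mathcomp Require Import all_classical all_reals all_analysis.

Set Implicit Arguments.
Unset Strict Implicit.
Unset Printing Implicit Defensive.

Import Order.TTheory GRing.Theory Num.Theory.
Import numFieldNormedType.Exports.

Local Open Scope ring_scope.

(* Cl_{0,m} with coefficients in K: the element a stands for                  *)
(* \sum_A a A *: e_A, where e_A is the product of the e_i, i \in A, in        *)
(* increasing order of i.                                                     *)
Definition clifford (K : comNzRingType) (m : nat) := {ffun {set 'I_m} -> K}.

Section CliffordAlgebra.
Variables (K : comNzRingType) (m : nat).
Local Notation Cl := (clifford K m).
Implicit Types (A B C D : {set 'I_m}) (a b c : Cl).

HB.instance Definition _ := GRing.Lmodule.copy Cl {ffun {set 'I_m} -> K^o}.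

Definition symdiff A B := (A :\: B) :|: (B :\: A).

(* e_A * e_B = cl_sign A B *: e_(symdiff A B): sorting the concatenated word  *)
(* costs one sign for each i \in A, j \in B with j < i (anticommutation) and  *)
(* one for each i = j (as e_i ^+ 2 = -1).                                     *)
Definition cl_sign A B : K :=
  (-1) ^+ (\sum_(i in A) \sum_(j in B) (j <= i)%N)%N.

Definition cl_one : Cl := [ffun A => (A == finset.set0)%:R].

Definition cl_mul a b : Cl :=
  [ffun C : {set 'I_m} =>
     \sum_A cl_sign A (symdiff A C) * a A * b (symdiff A C)].

Lemma in_symdiff A B i : (i \in symdiff A B) = (i \in A) (+) (i \in B).
Proof. by rewrite !inE; do 2 case: (i \in _). Qed.

Lemma symdiffK A : involutive (symdiff A).
Proof. by move=> B; apply/finset.setP => i; rewrite !in_symdiff addKb. Qed.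

Lemma symdiffA A B C : symdiff A (symdiff B C) = symdiff (symdiff A B) C.
Proof. by apply/finset.setP => i; rewrite !in_symdiff addbA. Qed.

Lemma symdiffC A B : symdiff A B = symdiff B A.
Proof. by apply/finset.setP => i; rewrite !in_symdiff addbC. Qed.

Lemma symdiff0 A : symdiff A finset.set0 = A.
Proof. by apply/finset.setP => i; rewrite !in_symdiff finset.in_set0 addbF. Qed.

Lemma symdiffv A : symdiff A A = finset.set0.
Proof. by apply/finset.setP => i; rewrite !in_symdiff finset.in_set0 addbb. Qed.

Lemma odd_sum_symdiff A B (f : 'I_m -> nat) :
  odd (\sum_(i in symdiff A B) f i)
  = odd (\sum_(i in A) f i) (+) odd (\sum_(i in B) f i).
Proof.
rewrite -oddD !(big_mkcond (fun i => i \in _)) -big_split /=.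
rewrite !(big_morph odd oddD (erefl : odd 0 = false)).
apply: eq_bigr => i _; rewrite in_symdiff.
by do 2 case: (i \in _); rewrite /= ?addn0 ?oddD ?addbb.
Qed.

Lemma cl_sign_symdiffl A B C :
  cl_sign (symdiff A B) C = cl_sign A C * cl_sign B C.
Proof.
rewrite /cl_sign -signr_odd odd_sum_symdiff signr_addb.
by rewrite !signr_odd.
Qed.

Lemma cl_sign_symdiffr A B C :
  cl_sign A (symdiff B C) = cl_sign A B * cl_sign A C.
Proof.
rewrite /cl_sign (exchange_big_dep predT) //=.
rewrite [in RHS](exchange_big_dep predT) //=.
rewrite [X in _ * (-1) ^+ X](exchange_big_dep predT) //=.
have E (D : {set 'I_m}) : (\sum_(j < m) \sum_(i in A | j \in D) (j <= i)%N
   = \sum_(j in D) \sum_(i in A) (j <= i)%N)%N.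
  rewrite [in RHS]big_mkcond; apply: eq_bigr => j _.
  by case: (j \in D); [apply: eq_bigl => i; rewrite andbT
     | rewrite big_pred0 // => i; rewrite andbF].
rewrite !E -signr_odd odd_sum_symdiff signr_addb.
by rewrite !signr_odd.
Qed.

Lemma cl_sign0l C : cl_sign finset.set0 C = 1.
Proof. by rewrite /cl_sign finset.big_set0. Qed.

Lemma cl_sign0r C : cl_sign C finset.set0 = 1.
Proof. by rewrite /cl_sign big1 // => i _; rewrite finset.big_set0. Qed.

Lemma cl_signM A B : cl_sign A B * cl_sign A B = 1.
Proof. by rewrite /cl_sign -expr2 sqrr_sign. Qed.

Lemma cl_mulA : associative cl_mul.
Proof.
move=> a b c; apply/ffunP => D; rewrite !ffunE.
under eq_bigr do rewrite ffunE mulr_sumr.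
under [RHS]eq_bigr do rewrite ffunE mulr_sumr mulr_suml.
rewrite [RHS]exchange_big /=; apply: eq_bigr => A _.
rewrite (reindex_inj (can_inj (symdiffK A))) /=; apply: eq_bigr => E _.
have -> : symdiff (symdiff A E) (symdiff A D) = symdiff E D.
  by rewrite symdiffA (symdiffC (symdiff A E)) symdiffK.
set X := symdiff E D.
have -> : symdiff A D = symdiff (symdiff A E) X.
  by rewrite /X -symdiffA symdiffK.
rewrite (cl_sign_symdiffl A E X) (cl_sign_symdiffr A (symdiff A E) X).
have := cl_signM A X; set u := cl_sign A X => uu.
by rewrite -[RHS]mul1r -uu; ring.
Qed.

Lemma cl_mul1 : left_id cl_one cl_mul.
Proof.
move=> a; apply/ffunP => C; rewrite ffunE (bigD1 finset.set0) //=.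
rewrite big1 => [|A /negbTE A0]; last by rewrite ffunE A0 mulr0 mul0r.
by rewrite ffunE eqxx cl_sign0l (symdiffC finset.set0) symdiff0 !mul1r addr0.
Qed.

Lemma cl_mulr1 : right_id cl_one cl_mul.
Proof.
move=> a; apply/ffunP => C; rewrite ffunE (bigD1 C) //=.
rewrite big1 => [|A AC].
  by rewrite ffunE symdiffv eqxx cl_sign0r !mul1r mulr1 addr0.
rewrite ffunE; case: eqP => [AC0|_]; last by rewrite mulr0.
by case/eqP: AC; rewrite -(symdiffK A C) AC0 symdiff0.
Qed.

Lemma cl_mulDl : left_distributive cl_mul +%R.
Proof.
move=> a b c; apply/ffunP => C; rewrite !ffunE -big_split /=.
by apply: eq_bigr => A _; rewrite !ffunE mulrDr mulrDl.
Qed.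

Lemma cl_mulDr : right_distributive cl_mul +%R.
Proof.
move=> a b c; apply/ffunP => C; rewrite !ffunE -big_split /=.
by apply: eq_bigr => A _; rewrite !ffunE mulrDr.
Qed.

Lemma cl_one_neq0 : cl_one != 0.
Proof.
apply/eqP => /ffunP/(_ finset.set0)/eqP.
by rewrite !ffunE eqxx oner_eq0.
Qed.

HB.instance Definition _ := GRing.Zmodule_isNzRing.Build Cl
  cl_mulA cl_mul1 cl_mulr1 cl_mulDl cl_mulDr cl_one_neq0.

Lemma cl_scaleAl (k : K) a b : k *: (a * b) = k *: a * b.
Proof.
apply/ffunP => C; rewrite !ffunE [LHS]mulr_sumr.
by apply: eq_bigr => A _; rewrite !ffunE !mulrA [k * _]mulrC.
Qed.

HB.instance Definition _ := GRing.Lmodule_isLalgebra.Build K Cl cl_scaleAl.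

Lemma cl_scaleAr (k : K) a b : k *: (a * b) = a * (k *: b).
Proof.
apply/ffunP => C; rewrite !ffunE [LHS]mulr_sumr.
by apply: eq_bigr => A _; rewrite !ffunE mulrCA.
Qed.

HB.instance Definition _ := GRing.Lalgebra_isAlgebra.Build K Cl cl_scaleAr.

Definition cl_gen (i : 'I_m) : Cl :=
  [ffun A : {set 'I_m} => (A == [set i])%:R].

Lemma cl_genM i j :
  cl_gen i * cl_gen j =
  (-1) ^+ (j <= i)%N *: ([ffun A => (A == symdiff [set i] [set j])%:R] : Cl).
Proof.
apply/ffunP => C; rewrite !ffunE (bigD1 [set i]) //= big1 => [|A /negbTE Ai].
  rewrite addr0 !ffunE eqxx mulr1.
  have -> : (symdiff [set i] C == [set j]) = (C == symdiff [set i] [set j]).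
    by apply/eqP/eqP => [<-|->]; rewrite symdiffK.
  case: eqP => [->|_]; last by rewrite !mulr0 scaler0.
  by rewrite symdiffK /cl_sign finset.big_set1 finset.big_set1.
by rewrite ffunE Ai mulr0 mul0r.
Qed.

Lemma cl_gen_sqr i : cl_gen i * cl_gen i = -1.
Proof.
by rewrite cl_genM leqnn symdiffv expr1 scaleN1r.
Qed.

Lemma cl_gen_anticomm i j :
  i != j -> cl_gen i * cl_gen j + cl_gen j * cl_gen i = 0.
Proof.
move=> ij; rewrite !cl_genM (symdiffC [set j]) -scalerDl.
by case: (ltngtP i j) => [||/val_inj/eqP];
  rewrite ?(negbTE ij) // => _; rewrite ?addrN ?addNr scale0r.
Qed.

End CliffordAlgebra.

Section CliffordFourier.
Variables (R : realType) (m : nat).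
Local Notation Cl := (clifford R[i] m).
Implicit Types (x y : 'rV[R]_m) (a : Cl) (F : 'rV[R]_m -> Cl).

(* Euclidean product and norm; the library norm on 'rV[R]_m is the sup norm.  *)
Definition dotp x y : R := \sum_(j < m) x 0 j * y 0 j.
Definition enorm x : R := Num.sqrt (dotp x x).

Definition wedge x y : Cl :=
  \sum_(j < m) \sum_(k < m | (j < k)%N)
    (x 0 j * y 0 k - x 0 k * y 0 j)%:C%C *: (cl_gen _ j * cl_gen _ k).

Definition cl_norm a : R :=
  Num.sqrt (\sum_A (complex.Re (a A) ^+ 2 + complex.Im (a A) ^+ 2)).

Definition cexp (z : R[i]) : R[i] :=
  (expR (complex.Re z))%:C%C *
  (cos (complex.Im z) +i* sin (complex.Im z))%C.

(* Limits and partial derivatives in the finite-dimensional real space Cl are *)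
(* taken coordinatewise.                                                      *)
Definition cl_is_cvg (u : nat -> Cl) : Prop :=
  forall A, cvgn (fun n => complex.Re (u n A))
         /\ cvgn (fun n => complex.Im (u n A)).

Definition cl_lim (u : nat -> Cl) : Cl :=
  [ffun A => (limn (fun n => complex.Re (u n A))
           +i* limn (fun n => complex.Im (u n A)))%C].

Definition cl_partial (j : 'I_m) F y : Cl :=
  [ffun A => ('D_(delta_mx 0 j) (fun z => complex.Re (F z A)) y
           +i* 'D_(delta_mx 0 j) (fun z => complex.Im (F z A)) y)%C].

Definition Gamma F y : Cl :=
  - \sum_(j < m) \sum_(k < m | (j < k)%N)
      cl_gen _ j * cl_gen _ k *
      ((y 0 j)%:C%C *: cl_partial k F y - (y 0 k)%:C%C *: cl_partial j F y).

Definition exp_iGamma_series (beta : R) F y : nat -> Cl :=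
  series (fun n => (('i%C * beta%:C%C) ^+ n / (n`!)%:R) *: iter n Gamma F y).

Definition exp_iGamma (beta : R) F y : Cl :=
  cl_lim (exp_iGamma_series beta F y).

Definition cot (alpha : R) : R := cos alpha / sin alpha.

(* e^{-i <x,y> / sin alpha} and e^{(i/2) (cot alpha) (|x|^2 + |y|^2)}         *)
Definition plane_wave (alpha : R) x y : Cl :=
  (cexp (- 'i%C * (dotp x y / sin alpha)%:C%C))%:A.
Definition chirp (alpha : R) x y : R[i] :=
  cexp ('i%C * (cot alpha / 2 * (enorm x ^+ 2 + enorm y ^+ 2))%:C%C).

Definition frac_CF_kernel (alpha beta : R) x y : Cl :=
  chirp alpha x y *: exp_iGamma beta (plane_wave alpha x) y.

End CliffordFourier.

(* sin (c t) / t, extended to t = 0 by its limit *)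
Definition sin_quot (R : realType) (c t : R) : R :=
  if t == 0 then lim (sin (s * c) / s @[s --> 0^'])%classic
  else sin (t * c) / t.

(* Main.v *)
Require Import Defs.
From mathcomp Require Import all_boot all_order all_algebra.
From mathcomp Require Import complex.
From mathcomp Require Import all_classical all_reals all_analysis.
From mathcomp Require Import ring lra.

(** Put s = sin alpha, write e12 = e_1 e_2 and let f(y) = exp(-i <x,y> / s).
In the plane Gamma = - e12 L, where L = y_1 d/dy_2 - y_2 d/dy_1 generates the
rotations, so the n-th term of the series of exp(i beta Gamma) f is
(beta^n / n!) L^n f(y) J^n with J = - i e12. Since e12^2 = -1, J^2 = 1, hence
J^n = P + (-1)^n Q with P = (1 + J)/2 and Q = (1 - J)/2, and the series is the
sum of the Taylor series at 0 of h(theta) = f(rotation of y by theta),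
evaluated at beta and multiplied by P, and evaluated at - beta and multiplied
by Q. With a = <x,y> / s and b = (x_2 y_1 - x_1 y_2) / s,
  h(theta) = exp(- i (a cos theta + b sin theta)),
which is entire, so the sum is h(beta) P + h(-beta) Q. Expanding the
exponentials gives
  exp(-i a cos beta) (cos(b sin beta) - sin(b sin beta) e12),
which is the formula, because the wedge product of x and y is - s b e12.

Two points need work. First, L^n f must be computed from iterated partial
derivatives. As L a = b and L b = - a, the derivatives of order n of the phase
cycle through a, b, -a, -b, and the derivatives of the exponential of a
function are given by the complete Bell polynomials [bell] in the derivatives
of that function; so L^n f(y) and h^(n)(theta) are values of the same function
[wave_jet] ([has_cdiff_wave_jet]), one at (a, b) and the other at the
phase and its derivative at theta.

Second, the Taylor series of h must be shown to converge to h on the whole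
line, which boundedness of the n-th derivative by a multiple of n! r^n
with a fixed r would not give. All the derivatives of the phase are bounded by
one constant M, so h^(n) is bounded by a multiple of the Bell polynomial with
all arguments equal to M (a Touchard polynomial), and these are
O(n! r^n) for every r > 0 ([bell_bound]); this makes the remainder in Taylor's
formula tend to 0 ([taylor_cvg], [wave_jet_taylor]). *)

Import Order.TTheory GRing.Theory Num.Theory.
Import numFieldNormedType.Exports.
Local Open Scope ring_scope.
Set Implicit Arguments.
Unset Strict Implicit.
Unset Printing Implicit Defensive.

(** * Complete Bell polynomials *)

Section Bell.
Variable K : comNzRingType.
Implicit Types (c : nat -> K).

(** The recurrence for [bell c n.+1] involves all the earlier values, so they
are accumulated in a list. *)
Fixpoint bell_seq c n : seq K :=
  if n is m.+1 then
    let s := bell_seq c m in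
    rcons s (\sum_(j < m.+1) (c j * s`_(m - j)) *+ 'C(m, j))
  else [:: 1].

(** The complete Bell polynomial of degree n in c_0, c_1, ...; if c_j is the
derivative of order j+1 of a function f, then the n-th derivative of exp f is
[exp f * bell c n]. *)
Definition bell c n : K := (bell_seq c n)`_n.

Lemma size_bell_seq c n : size (bell_seq c n) = n.+1.
Proof. by elim: n => //= n IH; rewrite size_rcons IH. Qed.

Lemma nth_bell_seq c n k : (k <= n)%N -> (bell_seq c n)`_k = bell c k.
Proof.
elim: n => [|n IH]; first by rewrite leqn0 => /eqP ->.
rewrite leq_eqVlt => /orP[/eqP -> //|kn].
by rewrite /= nth_rcons size_bell_seq kn IH.
Qed.

Lemma bell0 c : bell c 0 = 1. Proof. by []. Qed.

Lemma bellS c n :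
  bell c n.+1 = \sum_(j < n.+1) (c j * bell c (n - j)) *+ 'C(n, j).
Proof.
rewrite /bell /= nth_rcons size_bell_seq ltnn eqxx; apply: eq_bigr => j _.
by rewrite nth_bell_seq // leq_subr.
Qed.

(** Pascal's rule: this is the step from n to n+1 in Leibniz' formula, where
differentiation shifts the index of c or that of E. *)
Lemma binomial_conv_shift (c E : nat -> K) n :
  \sum_(j < n.+2) (c j * E (n.+1 - j)%N) *+ 'C(n.+1, j) =
  \sum_(j < n.+1) (c j.+1 * E (n - j)%N + c j * E (n - j).+1) *+ 'C(n, j).
Proof.
under [RHS]eq_bigr do rewrite mulrnDl.
rewrite big_split /= big_ord_recl /=.
under eq_bigr => j _ do rewrite /bump /= add1n binS mulrnDr subSS.
rewrite big_split /= addrA addrC; congr (_ + _).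
transitivity (\sum_(j < n.+2) (c j * E (n.+1 - j)%N) *+ 'C(n, j)).
  by rewrite [RHS]big_ord_recl /= !bin0 !mulr1n.
rewrite big_ord_recr /= bin_small // mulr0n addr0.
by apply: eq_bigr => j _; rewrite subSn // -ltnS.
Qed.

End Bell.

(** * Differentials of complex-valued functions *)

Section ReIm.
Variable R : realType.
Implicit Types p q : R[i].

Lemma cReD p q : complex.Re (p + q) = complex.Re p + complex.Re q.
Proof. by case: p q => [? ?] [? ?]. Qed.

Lemma cImD p q : complex.Im (p + q) = complex.Im p + complex.Im q.
Proof. by case: p q => [? ?] [? ?]. Qed.

Lemma cReM p q : complex.Re (p * q) =
  complex.Re p * complex.Re q - complex.Im p * complex.Im q.
Proof. by case: p q => [? ?] [? ?]. Qed.

Lemma cImM p q : complex.Im (p * q) =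
  complex.Re p * complex.Im q + complex.Im p * complex.Re q.
Proof. by case: p q => [? ?] [? ?]. Qed.

End ReIm.

Section ComplexDerivative.
Variables (R : realType) (V : normedModType R) (y v : V).
Local Notation C := R[i].
Implicit Types (f g : V -> R) (F G : V -> C).

(** Total differentiability, rather than the existence of the derivative along
v alone, is carried along because the angular derivative is a combination of
partial derivatives, and the existence of these is not enough for them to add up
to a directional derivative. *)
Definition has_diff f l := differentiable f y /\ 'd f y v = l.

Definition has_cdiff F l :=
  has_diff (fun z => complex.Re (F z)) (complex.Re l) /\
  has_diff (fun z => complex.Im (F z)) (complex.Im l).

Lemma has_diff_eq f a b : has_diff f a -> a = b -> has_diff f b.
Proof. by move=> ? <-. Qed.

Lemma has_diff_cst a : has_diff (fun=> a) 0.
Proof. by split; [exact: differentiable_cst|rewrite diff_cst]. Qed.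

Lemma has_diffD f g a b :
  has_diff f a -> has_diff g b -> has_diff (fun z => f z + g z) (a + b).
Proof.
move=> [df <-] [dg <-]; split; first exact: differentiableD.
by have /(congr1 (fun h => h v)) -> := diffD df dg.
Qed.

Lemma has_diffB f g a b :
  has_diff f a -> has_diff g b -> has_diff (fun z => f z - g z) (a - b).
Proof.
move=> [df <-] [dg <-]; split; first exact: differentiableB.
by have /(congr1 (fun h => h v)) -> := diffB df dg.
Qed.

Lemma has_diffM f g a b : has_diff f a -> has_diff g b ->
  has_diff (fun z => f z * g z) (a * g y + f y * b).
Proof.
move=> [df <-] [dg <-]; split; first exact: differentiableM.
have /(congr1 (fun h => h v)) -> := diffM df dg.
by rewrite addrC [in RHS]mulrC.
Qed.

Lemma has_diff_comp (h : R -> R) f a b :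
  is_derive (f y) 1 h b -> has_diff f a -> has_diff (fun z => h (f z)) (b * a).
Proof.
move=> [dh hb] [df <-].
have dh' : differentiable h (f y) by apply/derivable1_diffP.
split; first exact: (differentiable_comp df).
rewrite (_ : (fun z => h (f z)) = h \o f) // diff_comp //= deriv1E //=.
by rewrite derive1E hb mulrC.
Qed.

Lemma has_cdiff_cst z : has_cdiff (fun=> z) 0.
Proof. by split; apply: has_diff_cst. Qed.

Lemma has_cdiffD F G a b :
  has_cdiff F a -> has_cdiff G b -> has_cdiff (fun z => F z + G z) (a + b).
Proof.
move=> [f1 f2] [g1 g2]; split.
- by rewrite cReD; under eq_fun do rewrite cReD; exact: has_diffD.
- by rewrite cImD; under eq_fun do rewrite cImD; exact: has_diffD.
Qed.

Lemma has_cdiffM F G a b : has_cdiff F a -> has_cdiff G b ->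
  has_cdiff (fun z => F z * G z) (a * G y + F y * b).
Proof.
move=> [f1 f2] [g1 g2]; split.
- under eq_fun do rewrite cReM.
  by apply: (has_diff_eq (has_diffB (has_diffM f1 g1) (has_diffM f2 g2)));
    rewrite cReD !cReM; ring.
- under eq_fun do rewrite cImM.
  by apply: (has_diff_eq (has_diffD (has_diffM f1 g2) (has_diffM f2 g1)));
    rewrite cImD !cImM; ring.
Qed.

Lemma has_cdiffMn F a n :
  has_cdiff F a -> has_cdiff (fun z => F z *+ n) (a *+ n).
Proof.
move=> Fa; elim: n => [|n IH].
  by rewrite mulr0n; under eq_fun do rewrite mulr0n; exact: has_cdiff_cst.
by rewrite mulrS; under eq_fun do rewrite mulrS; exact: has_cdiffD.
Qed.

Lemma has_cdiff_sum n (F : 'I_n -> V -> C) (a : 'I_n -> C) :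
  (forall j, has_cdiff (F j) (a j)) ->
  has_cdiff (fun z => \sum_j F j z) (\sum_j a j).
Proof.
elim: n F a => [|n IH] F a Fa.
  by rewrite big_ord0; under eq_fun do rewrite big_ord0; exact: has_cdiff_cst.
rewrite big_ord_recl; under eq_fun do rewrite big_ord_recl.
by apply: has_cdiffD => //; apply: IH.
Qed.

(** The functions e_n = e bell(c, n) satisfy the recurrence of Leibniz' formula
for the derivatives of e, given that e' = c_0 e; as c_j' = c_{j+1}, each e_n is
then the derivative of the preceding one. *)
Lemma has_cdiff_bell (c : nat -> V -> C) e n :
  (forall j, has_cdiff (c j) (c j.+1 y)) -> has_cdiff e (c 0 y * e y) ->
  has_cdiff (fun z => e z * bell (c^~ z) n) (e y * bell (c^~ y) n.+1).
Proof.
move=> dc de.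
have rec z k : e z * bell (c^~ z) k.+1 =
    \sum_(j < k.+1) (c j z * (e z * bell (c^~ z) (k - j)%N)) *+ 'C(k, j).
  rewrite bellS mulr_sumr; apply: eq_bigr => j _.
  by rewrite mulrnAr mulrCA.
elim/ltn_ind: n => -[_|n IH].
  under eq_fun do rewrite bell0 mulr1.
  by rewrite rec big_ord1 subn0 bell0 mulr1 mulr1n.
under eq_fun do rewrite rec.
rewrite rec (binomial_conv_shift (c^~ y) (fun k => e y * bell (c^~ y) k)).
apply: has_cdiff_sum => j; apply: has_cdiffMn; apply: has_cdiffM => //.
by apply: IH; rewrite ltnS leq_subr.
Qed.

End ComplexDerivative.

(** * Taylor series of functions with slowly growing derivatives *)

Section Taylor.
Variable R : realType.
Implicit Types (x s : R) (u : nat -> R -> R) (B : nat -> R).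

Lemma has_diff_is_derive (f : R -> R) s l :
  has_diff s 1 f l -> is_derive s 1 f l.
Proof.
move=> [df <-]; rewrite -deriveE //; apply: DeriveDef => //.
exact: diff_derivable.
Qed.

Lemma is_derive_has_diff (f : R -> R) s l :
  is_derive s 1 f l -> has_diff s 1 f l.
Proof.
move=> [df <-]; have df' : differentiable f s by apply/derivable1_diffP.
by split=> //; rewrite deriveE.
Qed.

(** The Taylor polynomial for the value at x, with the base point t * x moving
from 0 to x: its derivative in t telescopes to a single term, which gives the
remainder by the mean value theorem on [0, 1], whatever the sign of x. *)
Lemma has_diff_taylor u x s n :
  (forall k (t : R), has_diff t 1 (u k) (u k.+1 t)) ->
  has_diff s 1
    (fun t => \sum_(k < n.+1) x ^+ k / k`!%:R * (u k (t * x) * (1 - t) ^+ k))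
    (x ^+ n.+1 / n`!%:R * (u n.+1 (s * x) * (1 - s) ^+ n)).
Proof.
move=> du.
have did : has_diff s 1 (fun t : R => t) 1.
  exact: (is_derive_has_diff (is_derive_id _ _)).
have dx : has_diff s 1 (fun t => t * x) x.
  by apply: (has_diff_eq (has_diffM did (has_diff_cst _ _ x))); ring.
have dux k : has_diff s 1 (fun t => u k (t * x)) (u k.+1 (s * x) * x).
  exact: has_diff_comp (has_diff_is_derive (du k _)) dx.
have dp k : has_diff s 1 (fun t => (1 - t) ^+ k) (- (1 - s) ^+ k.-1 *+ k).
  have dm : has_diff s 1 (fun t : R => 1 - t) (- 1).
    by apply: (has_diff_eq (has_diffB (has_diff_cst _ _ 1) did)); ring.
  have dX : is_derive (1 - s) 1 (fun t : R => t ^+ k)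
      ((1 - s) ^+ k.-1 *+ k).
    apply: DeriveDef; first exact: exprn_derivable.
    by rewrite exp_derive -[RHS]mulr_natl /GRing.scale /= mulr1.
  have H := @has_diff_comp R _ s 1 (fun t => t ^+ k) (fun t => 1 - t) _ _ dX dm.
  by apply: (has_diff_eq H); rewrite mulrN1 mulNrn.
have dterm k : has_diff s 1
    (fun t => x ^+ k / k`!%:R * (u k (t * x) * (1 - t) ^+ k))
    (x ^+ k / k`!%:R * (u k.+1 (s * x) * x * (1 - s) ^+ k
       + u k (s * x) * (- (1 - s) ^+ k.-1 *+ k))).
  apply: (has_diff_eq
    (has_diffM (has_diff_cst _ _ _) (has_diffM (dux k) (dp k)))).
  by ring.
elim: n => [|n IH].
  under eq_fun do rewrite big_ord1.
  by apply: (has_diff_eq (dterm 0%N)); rewrite mulr0n !expr0; field.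
under eq_fun do rewrite big_ord_recr /=.
apply: (has_diff_eq (has_diffD IH (dterm n.+1))).
have n0 : n`!%:R != 0 :> R by rewrite pnatr_eq0 -lt0n fact_gt0.
have n1 : n.+1%:R != 0 :> R by rewrite pnatr_eq0.
rewrite factS natrM mulNrn -[(1 - s) ^+ _ *+ _]mulr_natl /= !exprS.
by move: n1; move: (n.+1%:R) => N n1; field; rewrite n0 n1.
Qed.

Lemma taylor_remainder u x B n :
  (forall k (t : R), has_diff t 1 (u k) (u k.+1 t)) ->
  (forall k t, `|u k t| <= B k) ->
  `|u 0 x - \sum_(k < n.+1) x ^+ k / k`!%:R * u k 0|
    <= B n.+1 * (`|x| ^+ n.+1 / n`!%:R).
Proof.
move=> du ub.
pose D t := \sum_(k < n.+1) x ^+ k / k`!%:R * (u k (t * x) * (1 - t) ^+ k).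
pose D' s := x ^+ n.+1 / n`!%:R * (u n.+1 (s * x) * (1 - s) ^+ n).
have dD s : has_diff s 1 D (D' s) by exact: has_diff_taylor.
have D1 : D 1 = u 0 x.
  rewrite /D big_ord_recl /= big1 => [|k _].
    by rewrite fact0 !expr0 !mul1r mulr1 invr1 mul1r addr0.
  by rewrite subrr /bump /= add1n [0 ^+ _]exprS !(mul0r, mulr0).
have D0 : D 0 = \sum_(k < n.+1) x ^+ k / k`!%:R * u k 0.
  by apply: eq_bigr => k _; rewrite mul0r subr0 expr1n mulr1.
rewrite -D1 -D0.
have [||c] := @MVT_segment R D D' 0 1 ler01.
- move=> s _; exact: (has_diff_is_derive (dD s)).
- apply: continuous_subspaceT => s.
  by apply: differentiable_continuous; case: (dD s).
rewrite in_itv /= => /andP[c0 c1] ->.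
rewrite subr0 mulr1 normrM mulrC ler_pM //.
- rewrite normrM -[leRHS]mulr1 ler_pM // normrX exprn_ile1 //.
  by rewrite ger0_norm; lra.
- by rewrite normrM normrX normfV normr_nat.
Qed.

Lemma taylor_cvg u x B :
  (forall k (t : R), has_diff t 1 (u k) (u k.+1 t)) ->
  (forall k t, `|u k t| <= B k) ->
  ((B n.+1 * (`|x| ^+ n.+1 / n`!%:R)) @[n --> \oo] --> (0 : R))%classic ->
  (series (fun n => x ^+ n / n`!%:R * u n 0) @ \oo --> u 0 x)%classic.
Proof.
move=> du ub B0.
rewrite -cvg_shiftS; apply/cvgrPdist_le => /= e e0.
move/cvgrPdist_le : B0 => /(_ e e0); apply: filterS => n.
rewrite sub0r normrN => Be.
rewrite /series /= big_mkord; apply: le_trans (taylor_remainder x n du ub) _.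
exact: le_trans (ler_norm _) Be.
Qed.

End Taylor.

(** * Growth of the Bell polynomials *)

Section BellBound.
Variable R : realType.
Implicit Types c r x : R.

Lemma bell_ge0 c n : 0 <= c -> 0 <= bell (fun=> c) n.
Proof.
move=> c0; elim/ltn_ind: n => -[|n] IH; first by rewrite bell0.
rewrite bellS sumr_ge0 // => j _; rewrite mulrn_wge0 // mulr_ge0 //.
by rewrite IH // ltnS leq_subr.
Qed.

Lemma exp_coeff_sum_le x n : 0 <= x ->
  \sum_(j < n) x ^+ j / j`!%:R <= expR x.
Proof.
move=> x0; rewrite -(big_mkord xpredT (fun j => x ^+ j / j`!%:R)).
apply: (nondecreasing_cvgn_le (u_ := series (exp_coeff x))).
  apply/nondecreasing_seqP => k; rewrite /series /= big_nat_recr //= lerDl.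
  exact: exp_coeff_ge0.
exact: is_cvg_series_exp_coeff.
Qed.

(** Put t_n = bell(c, n) / n! with all arguments equal to c. The recurrence
reads (n+1) t_{n+1} = c sum_j t_{n-j} / j!, so a bound t_k <= C r^k for
k <= n gives t_{n+1} <= C r^n c exp(1/r) / (n+1), which is at most C r^{n+1} as
soon as n+1 >= c exp(1/r) / r; the finitely many earlier indices are absorbed
in C. *)
Lemma bell_bound c r : 0 <= c -> 0 < r ->
  exists2 C, 0 <= C & forall n, bell (fun=> c) n <= C * r ^+ n * n`!%:R.
Proof.
move=> c0 r0; pose T := bell (fun=> c); have T0 k : 0 <= T k by apply: bell_ge0.
have f0 k : 0 < k`!%:R :> R by rewrite ltr0n fact_gt0.
pose E := expR r^-1; pose N := (Num.truncn (c * E / r)).+1.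
have cE : c * E <= N%:R * r.
  by rewrite -ler_pdivrMr // ltW // truncnS_gt.
pose C := \sum_(k < N.+1) T k / (r ^+ k * k`!%:R).
have tge0 k : 0 <= T k / (r ^+ k * k`!%:R).
  by rewrite divr_ge0 // mulr_ge0 ?exprn_ge0 // ltW.
have C0 : 0 <= C by apply: sumr_ge0.
exists C => // n; elim/ltn_ind: n => n IH.
have [nN|] := ltnP n N.+1.
  rewrite -mulrA -ler_pdivrMr ?mulr_gt0 ?exprn_gt0 //.
  by rewrite /C (bigD1 (Ordinal nN)) //= lerDl sumr_ge0.
case: n IH => // n IH; rewrite ltnS => Nn.
rewrite bellS.
apply: (@le_trans _ _ (\sum_(j < n.+1)
    c * C * r ^+ n * n`!%:R * ((r^-1) ^+ j / j`!%:R))).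
  apply: ler_sum => j _; have jn : (j <= n)%N by rewrite -ltnS.
  have IHj : T (n - j)%N <= C * r ^+ (n - j) * (n - j)`!%:R.
    by apply: IH; rewrite ltnS leq_subr.
  have -> : c * C * r ^+ n * n`!%:R * ((r^-1) ^+ j / j`!%:R) =
      (c * (C * r ^+ (n - j) * (n - j)`!%:R)) * 'C(n, j)%:R.
    rewrite -(bin_fact jn) !natrM -{1}(subnK jn) exprD exprVn.
    by field; rewrite !gt_eqF ?exprn_gt0.
  by rewrite -mulr_natr ler_wpM2r // ler_wpM2l.
rewrite -mulr_sumr.
have rV : 0 <= r^-1 by rewrite invr_ge0 ltW.
apply: le_trans (ler_wpM2l _ (exp_coeff_sum_le n.+1 rV)) _.
  by rewrite !mulr_ge0 ?exprn_ge0 // ltW.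
rewrite -/E (_ : _ * E = (C * r ^+ n * n`!%:R) * (c * E)); last by ring.
have -> : C * r ^+ n.+1 * n.+1`!%:R = (C * r ^+ n * n`!%:R) * (n.+1%:R * r).
  by rewrite factS natrM exprS; ring.
apply: ler_wpM2l; first by rewrite !mulr_ge0 ?exprn_ge0 // ltW.
apply: le_trans cE _; apply: ler_wpM2r; first exact: ltW.
by rewrite ler_nat ltnW.
Qed.

Lemma bell_remainder_cvg0 c M x : 0 <= c -> 0 <= M ->
  ((M * bell (fun=> c) n.+1 * (`|x| ^+ n.+1 / n`!%:R))
     @[n --> \oo] --> (0 : R))%classic.
Proof.
move=> c0 M0.
(* With r |x| <= 1/4, the factor n+1 <= 2^(n+1) coming from (n+1)! / n! still
   leaves a geometric sequence of ratio 1/2. *)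
pose r : R := (4 * (`|x| + 1))^-1.
have x1 : 0 < `|x| + 1 by rewrite ltr_wpDl.
have r0 : 0 < r by rewrite invr_gt0 mulr_gt0.
have [C C0 bC] := bell_bound c0 r0.
apply: (@squeeze_cvgr _ _ _ _ (cst 0) (geometric (M * C) 2^-1)); last 2 first.
- exact: cvg_cst.
- by apply: cvg_geometric; rewrite ger0_norm ?invf_lt1 ?invr_ge0 // ltr1n.
apply: nearW => n /=.
have f0 : 0 < n`!%:R :> R by rewrite ltr0n fact_gt0.
rewrite mulr_ge0 ?divr_ge0 ?exprn_ge0 ?mulr_ge0 ?bell_ge0 ?(ltW f0) //=.
rewrite -!mulrA; apply: ler_wpM2l => //.
apply: le_trans (ler_wpM2r _ (bC n.+1)) _.
  by rewrite mulr_ge0 ?exprn_ge0 // invr_ge0 ltW.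
rewrite -!mulrA; apply: ler_wpM2l => //.
have -> : r ^+ n.+1 * (n.+1`!%:R * (`|x| ^+ n.+1 / n`!%:R)) =
    n.+1%:R * (r * `|x|) ^+ n.+1.
  by rewrite factS natrM exprMn; field; rewrite gt_eqF.
have rx : r * `|x| <= 4^-1.
  rewrite /r invfM -mulrA ler_piMr ?invr_ge0 // ler_pdivrMl // mulr1.
  by rewrite lerDl.
have rx0 : 0 <= r * `|x| by rewrite mulr_ge0 // ltW.
apply: (@le_trans _ _ (2 ^+ n.+1 * (4^-1) ^+ n.+1)).
  apply: ler_pM => //; rewrite ?exprn_ge0 //.
    by rewrite -natrX ler_nat ltnW // ltn_expl.
  by apply: lerXn2r; rewrite ?nnegrE ?invr_ge0.
rewrite -exprMn (_ : 2 * 4^-1 = 2^-1 :> R); last by field.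
by rewrite exprS ler_piMl ?exprn_ge0 // ?invr_ge0 // invf_le1 // ler1n.
Qed.

End BellBound.

(** * Angular derivatives of a plane wave *)

Section Wave.
Variable R : realType.
Local Notation C := R[i].
Implicit Types a b x s : R.

(** The derivatives at 0 of theta |-> a cos theta + b sin theta, namely
a, b, -a, -b, a, ... *)
Fixpoint jet a b n : R := if n is m.+1 then jet b (- a) m else a.

(** exp (- i a) *)
Definition wave a : C := (cos a +i* - sin a)%C.

(** The derivative of order n of exp(-i g) at a point where g is equal to a, g'
to b, g'' to -a, and so on. *)
Definition wave_jet n a b : C :=
  wave a * bell (fun j => (0 +i* - jet a b j.+1)%C) n.

Lemma wave_jet0 a b : wave_jet 0 a b = wave a.
Proof. by rewrite /wave_jet bell0 mulr1. Qed.

Lemma waveD a b : wave (a + b) = wave a * wave b.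
Proof.
rewrite /wave cosD sinD; apply/eqP; rewrite eq_complex /=.
by apply/andP; split; apply/eqP; ring.
Qed.

Lemma cexp_Ni a : cexp (- 'i%C * a%:C%C) = wave a.
Proof.
rewrite /cexp /wave /= !(mul0r, mulr0, mulN1r, subr0, addr0, oppr0, add0r).
by rewrite expR0 mul1r cosN sinN.
Qed.

Section Derivative.
Variables (V : normedModType R) (y v : V).

Lemma has_diffN (f : V -> R) l :
  has_diff y v f l -> has_diff y v (fun z => - f z) (- l).
Proof.
move=> df; have := has_diffB (has_diff_cst y v 0) df; rewrite sub0r.
by under eq_fun do rewrite sub0r.
Qed.

Lemma has_diff_jet (f g : V -> R) n :
  has_diff y v f (g y) -> has_diff y v g (- f y) ->
  has_diff y v (fun z => jet (f z) (g z) n) (jet (f y) (g y) n.+1).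
Proof.
elim: n f g => [|n IH] f g df dg //=.
by apply: (IH g (fun z => - f z)) => //; exact: has_diffN.
Qed.

(** Along any direction in which (f, g) moves as on a circle, that is f' = g
and g' = -f, differentiation increases the order of [wave_jet] by one. This
covers the angular derivative in the plane and the derivative in the angle. *)
Lemma has_cdiff_wave_jet (f g : V -> R) n :
  has_diff y v f (g y) -> has_diff y v g (- f y) ->
  has_cdiff y v (fun z => wave_jet n (f z) (g z)) (wave_jet n.+1 (f y) (g y)).
Proof.
move=> df dg.
apply: (has_cdiff_bell (c := fun j z => (0 +i* - jet (f z) (g z) j.+1)%C)
  (e := fun z => wave (f z))).
  move=> j; split; first exact: has_diff_cst.
  exact: has_diffN (has_diff_jet _ df dg).
split=> /=.
  by apply: (has_diff_eq (has_diff_comp (is_derive_cos (f y)) df)); ring.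
apply: (has_diff_eq (has_diffN (has_diff_comp (is_derive_sin (f y)) df))).
by ring.
Qed.

End Derivative.

(** A submultiplicative norm with values in R, which avoids square roots. *)
Definition csize (z : C) : R := `|complex.Re z| + `|complex.Im z|.

Lemma csizeD (z1 z2 : C) : csize (z1 + z2) <= csize z1 + csize z2.
Proof.
by rewrite /csize cReD cImD addrACA; apply: lerD; exact: ler_normD.
Qed.

Lemma csizeM (z1 z2 : C) : csize (z1 * z2) <= csize z1 * csize z2.
Proof.
rewrite /csize cReM cImM mulrDl !mulrDr -!normrM.
case: z1 z2 => [a b] [c d] /=.
have := ler_normD (a * d) (b * c).
have := ler_normB (a * c) (b * d).
lra.
Qed.

Lemma csizeMn (z : C) n : csize (z *+ n) <= csize z *+ n.
Proof.
elim: n => [|n IH]; first by rewrite !mulr0n /csize normr0 addr0.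
by rewrite !mulrS; apply: le_trans (csizeD _ _) _; rewrite lerD2l.
Qed.

Lemma csize_sum n (F : 'I_n -> C) : csize (\sum_j F j) <= \sum_j csize (F j).
Proof.
elim: n F => [|n IH] F; first by rewrite !big_ord0 /csize normr0 addr0.
rewrite !big_ord_recl; apply: le_trans (csizeD _ _) _.
by rewrite lerD2l.
Qed.

Lemma csize_bell (c : nat -> C) (M : R) n :
  0 <= M -> (forall j, csize (c j) <= M) ->
  csize (bell c n) <= bell (fun=> M) n.
Proof.
move=> M0 cM; elim/ltn_ind: n => -[|n] IH.
  by rewrite !bell0 /csize /= normr0 normr1 addr0.
rewrite !bellS; apply: le_trans (csize_sum _) _; apply: ler_sum => j _.
apply: le_trans (csizeMn _ _) _; rewrite lerMn2r; apply/orP; right.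
apply: le_trans (csizeM _ _) _; apply: ler_pM => //; rewrite ?addr_ge0 //.
by apply: IH; rewrite ltnS leq_subr.
Qed.

Lemma jet_le a b n : `|jet a b n| <= `|a| + `|b|.
Proof.
elim: n a b => [|n IH] a b /=; first by rewrite lerDl.
by apply: le_trans (IH _ _) _; rewrite normrN addrC.
Qed.

Lemma csize_wave_jet a b M n :
  `|a| + `|b| <= M -> csize (wave_jet n a b) <= 2 * bell (fun=> M) n.
Proof.
move=> abM; have M0 : 0 <= M by apply: le_trans abM; rewrite addr_ge0.
apply: le_trans (csizeM _ _) _; apply: ler_pM; rewrite ?addr_ge0 //.
  rewrite /csize /= normrN -[2]/(1 + 1) lerD //.
    by rewrite ler_norml cos_geN1 cos_le1.
  by rewrite ler_norml sin_geN1 sin_le1.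
apply: csize_bell => // j; rewrite /csize normr0 add0r normrN.
exact: le_trans (jet_le _ _ _) abM.
Qed.

(** * Taylor series along a circle *)

Definition ccvg (u : nat -> C) (l : C) :=
  ((complex.Re (u n) @[n --> \oo] --> complex.Re l)%classic /\
   (complex.Im (u n) @[n --> \oo] --> complex.Im l)%classic).

Lemma ccvgD (u w : nat -> C) (k l : C) :
  ccvg u k -> ccvg w l -> ccvg (fun n => u n + w n) (k + l).
Proof.
move=> [u1 u2] [w1 w2]; split.
- by rewrite cReD; under eq_fun do rewrite cReD; exact: cvgD.
- by rewrite cImD; under eq_fun do rewrite cImD; exact: cvgD.
Qed.

Lemma ccvgMr (u : nat -> C) (l z : C) :
  ccvg u l -> ccvg (fun n => u n * z) (l * z).
Proof.
move=> [u1 u2]; split.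
- rewrite cReM; under eq_fun do rewrite cReM.
  by apply: cvgB; apply: cvgMr_tmp.
- rewrite cImM; under eq_fun do rewrite cImM.
  by apply: cvgD; apply: cvgMr_tmp.
Qed.

Lemma Re_sum n (F : nat -> C) :
  complex.Re (\sum_(0 <= k < n) F k) = \sum_(0 <= k < n) complex.Re (F k).
Proof.
elim: n => [|n IH]; first by rewrite !big_geq.
by rewrite !big_nat_recr //= cReD IH.
Qed.

Lemma Im_sum n (F : nat -> C) :
  complex.Im (\sum_(0 <= k < n) F k) = \sum_(0 <= k < n) complex.Im (F k).
Proof.
elim: n => [|n IH]; first by rewrite !big_geq.
by rewrite !big_nat_recr //= cImD IH.
Qed.

(** The left-hand side is the Taylor series at 0 of
theta |-> exp(-i (a cos theta + b sin theta)); its derivatives are bounded by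
Bell polynomials because the phase and its derivatives are bounded. *)
Lemma wave_jet_taylor a b x :
  ccvg (series (fun n => (x ^+ n / n`!%:R)%:C%C * wave_jet n a b))
       (wave (a * cos x + b * sin x)).
Proof.
pose f s := a * cos s + b * sin s; pose g s := b * cos s - a * sin s.
pose M := 2 * (`|a| + `|b|).
have M0 : 0 <= M by rewrite mulr_ge0 ?addr_ge0.
have dcos s : has_diff s 1 (@cos R) (- sin s).
  exact: (is_derive_has_diff (is_derive_cos s)).
have dsin s : has_diff s 1 (@sin R) (cos s).
  exact: (is_derive_has_diff (is_derive_sin s)).
have df s : has_diff s 1 f (g s).
  apply: (has_diff_eq (has_diffD (has_diffM (has_diff_cst _ _ a) (dcos s))
    (has_diffM (has_diff_cst _ _ b) (dsin s)))).
  by rewrite /g; ring.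
have dg s : has_diff s 1 g (- f s).
  apply: (has_diff_eq (has_diffB (has_diffM (has_diff_cst _ _ b) (dcos s))
    (has_diffM (has_diff_cst _ _ a) (dsin s)))).
  by rewrite /f; ring.
have dF n s := has_cdiff_wave_jet n (df s) (dg s).
have fgM s : `|f s| + `|g s| <= M.
  have cl : `|cos s| <= 1 by rewrite ler_norml cos_geN1 cos_le1.
  have sl : `|sin s| <= 1 by rewrite ler_norml sin_geN1 sin_le1.
  have mul_le (p q : R) : `|q| <= 1 -> `|p * q| <= `|p|.
    by move=> ?; rewrite normrM ler_piMr.
  have := ler_normD (a * cos s) (b * sin s).
  have := ler_normB (b * cos s) (a * sin s).
  have := mul_le a _ cl; have := mul_le b _ cl.
  have := mul_le a _ sl; have := mul_le b _ sl.
  rewrite /M /f /g; lra.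
have bF n s := csize_wave_jet n (fgM s).
have B0 := bell_remainder_cvg0 x M0 (ler0n R 2).
have f0 : f 0 = a by rewrite /f cos0 sin0; ring.
have g0 : g 0 = b by rewrite /g cos0 sin0; ring.
split.
- have H : (series
      (fun n => x ^+ n / n`!%:R * complex.Re (wave_jet n (f 0) (g 0)))
      @ \oo --> complex.Re (wave_jet 0 (f x) (g x)))%classic.
    apply: (taylor_cvg (u := fun n s => complex.Re (wave_jet n (f s) (g s)))
      _ _ B0) => k t; first by case: (dF k t).
    by apply: le_trans (bF k t); rewrite lerDl.
  move: H; rewrite wave_jet0 f0 g0.
  rewrite (_ : series _ = fun n => complex.Re
    (series (fun n => (x ^+ n / n`!%:R)%:C%C * wave_jet n a b) n)) //.
  apply/funext => n; rewrite /series /= Re_sum.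
  by apply: eq_bigr => k _; rewrite [RHS]cReM /= mul0r subr0.
- have H : (series
      (fun n => x ^+ n / n`!%:R * complex.Im (wave_jet n (f 0) (g 0)))
      @ \oo --> complex.Im (wave_jet 0 (f x) (g x)))%classic.
    apply: (taylor_cvg (u := fun n s => complex.Im (wave_jet n (f s) (g s)))
      _ _ B0) => k t; first by case: (dF k t).
    by apply: le_trans (bF k t); rewrite lerDr.
  move: H; rewrite wave_jet0 f0 g0.
  rewrite (_ : series _ = fun n => complex.Im
    (series (fun n => (x ^+ n / n`!%:R)%:C%C * wave_jet n a b) n)) //.
  apply/funext => n; rewrite /series /= Im_sum.
  by apply: eq_bigr => k _; rewrite [RHS]cImM /= mul0r addr0.
Qed.

End Wave.

(** * Involutions in an algebra *)

Lemma expr_involution (K : fieldType) (A : algType K) (J : A) n :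
  2 != 0 :> K -> J * J = 1 ->
  J ^+ n = 2^-1 *: (1 + J) + (-1) ^+ n *: (2^-1 *: (1 - J)).
Proof.
move=> two0 J2.
have JPp : J * (2^-1 *: (1 + J)) = 2^-1 *: (1 + J).
  by rewrite -scalerAr mulrDr mulr1 J2 addrC.
have JPm : J * (2^-1 *: (1 - J)) = - (2^-1 *: (1 - J)).
  by rewrite -scalerAr mulrBr mulr1 J2 -scalerN opprB.
elim: n => [|n IH]; last first.
  by rewrite exprS IH mulrDr JPp -scalerAr JPm exprS mulN1r scaleNr scalerN.
rewrite !expr0 scale1r -scalerDr addrACA subrr addr0.
by rewrite -mulr2n -scaler_nat scalerA mulVf // scale1r.
Qed.

Lemma involution_combE (K : fieldType) (A : algType K) (J : A) (p q : K) :
  p *: (2^-1 *: (1 + J)) + q *: (2^-1 *: (1 - J)) =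
  ((p + q) / 2) *: 1 + ((p - q) / 2) *: J.
Proof.
rewrite !scalerA !scalerDr addrACA scalerN -scalerDl -scalerBl.
by rewrite -mulrDl -mulrBl.
Qed.

(** * The operator Gamma in the plane *)

Section Plane.
Variable R : realType.
Local Notation C := R[i].
Local Notation Cl := (clifford C 2).
Implicit Types (x y v : 'rV[R]_2) (c : Cl).

Local Notation i0 := (ord0 : 'I_2).
Local Notation i1 := (lift ord0 ord0 : 'I_2).

Lemma big_ord2_lt (T : nmodType) (F : 'I_2 -> 'I_2 -> T) :
  \sum_(j < 2) \sum_(k < 2 | (j < k)%N) F j k = F i0 i1.
Proof.
under eq_bigr do rewrite big_mkcond.
by rewrite !big_ord_recl !big_ord0 /= !(addr0, add0r).
Qed.

Lemma has_diff_coord y v j : has_diff y v (fun z : 'rV[R]_2 => z 0 j) (v 0 j).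
Proof.
split; first exact: differentiable_coord.
have @f : {linear 'rV[R]_2 -> R}.
  by exists (fun N : 'rV[R]_2 => N 0 j); do 2![eexists]; do ?[constructor];
     rewrite ?mxE // => ? *; rewrite ?mxE //; move=> ?; rewrite !mxE.
rewrite (_ : (fun _ => _) = f) // diff_lin //; exact: coord_continuous.
Qed.

Definition e12 : Cl := cl_gen _ i0 * cl_gen _ i1.

Lemma e12_sqr : e12 * e12 = -1.
Proof.
have ac : cl_gen C i1 * cl_gen C i0 = - e12.
  by apply/eqP; rewrite -addr_eq0 cl_gen_anticomm.
rewrite /e12 mulrA -(mulrA _ _ (cl_gen _ i0)) ac /e12.
by rewrite mulrN mulrA cl_gen_sqr mulN1r !mulNr cl_gen_sqr opprK.
Qed.

Lemma e12E (A : {set 'I_2}) : e12 A = (A == [set: 'I_2]%SET)%:R.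
Proof.
rewrite /e12 cl_genM /= expr0 scale1r ffunE.
congr (_ == _)%:R; apply/finset.setP => -[[|[|]] //= h];
  by rewrite in_symdiff !inE.
Qed.

(** The velocity at y of the rotation of the plane, so that the derivative along
it is y_1 d/dy_2 - y_2 d/dy_1. *)
Definition rot90 y : 'rV[R]_2 :=
  y 0 i0 *: delta_mx 0 i1 - y 0 i1 *: delta_mx 0 i0.

Lemma cl_partial_scale (h : 'rV[R]_2 -> C) c y j l :
  has_cdiff y (delta_mx 0 j) h l ->
  cl_partial j (fun z => h z *: c) y = l *: c.
Proof.
move=> dh; apply/ffunP => A; rewrite /cl_partial ffunE.
have [[d1 e1] [d2 e2]] := has_cdiffM dh (has_cdiff_cst _ _ (c A)).
rewrite (_ : (fun z => complex.Re _) =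
    fun z => complex.Re (h z * c A)); last first.
  by apply/funext => z; rewrite ffunE.
rewrite (_ : (fun z => complex.Im _) =
    fun z => complex.Im (h z * c A)); last first.
  by apply/funext => z; rewrite ffunE.
rewrite !deriveE // e1 e2 mulr0 addr0 ffunE.
by rewrite /GRing.scale /=; case: (l * c A).
Qed.

(** In the plane the double sum defining Gamma has a single term, so Gamma acts
on the scalar factor h as the angular derivative and on the other one as the
multiplication by - e12. *)
Lemma Gamma_scale (h : 'rV[R]_2 -> C) c y l :
  has_cdiff y (rot90 y) h l ->
  Gamma (fun z => h z *: c) y = l *: (- e12 * c).
Proof.
move=> [[d1 e1] [d2 e2]].
pose D j : C := ('d (fun z => complex.Re (h z)) y (delta_mx 0 j)
             +i* 'd (fun z => complex.Im (h z)) y (delta_mx 0 j))%C.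
have cp j : cl_partial j (fun z => h z *: c) y = D j *: c.
  by apply: cl_partial_scale; split; split.
rewrite /Gamma big_ord2_lt !cp !scalerA -scalerBl.
have -> : (y 0 i0)%:C%C * D i1 - (y 0 i1)%:C%C * D i0 = l.
  have combE (p q a b a' b' : R) :
      p%:C%C * (a +i* b)%C - q%:C%C * (a' +i* b')%C =
      ((p * a - q * a') +i* (p * b - q * b'))%C.
    apply/eqP; rewrite eq_complex /=.
    by apply/andP; split; apply/eqP; ring.
  have rotE (g : 'rV[R]_2 -> R) : 'd g y (rot90 y) =
      y 0 i0 * 'd g y (delta_mx 0 i1) - y 0 i1 * 'd g y (delta_mx 0 i0).
    by rewrite /rot90 linearB !linearZ.
  by rewrite combE -!rotE e1 e2; case: (l).
by rewrite -scalerAr mulNr scalerN.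
Qed.

Lemma cl_cvg (u : nat -> Cl) c : (forall A, ccvg (fun n => u n A) (c A)) ->
  cl_is_cvg u /\ cl_lim u = c.
Proof.
move=> uc; split=> [A|].
  by have [/cvgP ? /cvgP ?] := uc A.
apply/ffunP => A; rewrite ffunE; have [/cvg_lim -> // /cvg_lim -> //] := uc A.
by case: (c A).
Qed.

(** Each term of the series is a multiple of a power of the involution
J = - i e12; splitting the powers along (1 + J)/2 and (1 - J)/2 leaves the
Taylor series of [wave_jet_taylor] at beta and at - beta. *)
Lemma exp_iGamma_series_cvg (beta : R) (F : 'rV[R]_2 -> Cl) y (a b : R) :
  (forall n, iter n (@Gamma R 2) F y = wave_jet n a b *: (- e12) ^+ n) ->
  cl_is_cvg (exp_iGamma_series beta F y) /\
  exp_iGamma beta F y =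
    wave (a * cos beta) *:
      ((cos (b * sin beta))%:C%C%:A - (sin (b * sin beta))%:C%C *: e12).
Proof.
move=> iterF.
pose J : Cl := - ('i%C *: e12).
have J2 : J * J = 1.
  rewrite /J mulrNN -scalerAl -scalerAr e12_sqr scalerA.
  by rewrite -expr2 sqr_i scaleN1r opprK.
have JE : J = - ('i%C *: e12) by [].
clearbody J.
pose Pp : Cl := 2^-1 *: (1 + J); pose Pm : Cl := 2^-1 *: (1 - J).
have Jpow n : J ^+ n = Pp + (-1) ^+ n *: Pm.
  by apply: expr_involution; rewrite ?pnatr_eq0.
have PpE : Pp = 2^-1 *: (1 + J) := erefl.
have PmE : Pm = 2^-1 *: (1 - J) := erefl.
clearbody Pp Pm.
pose S (t : R) n : C := (t ^+ n / n`!%:R)%:C%C * wave_jet n a b.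
have termE n : (('i%C * beta%:C%C) ^+ n / (n`!)%:R) *: iter n (@Gamma R 2) F y =
    S beta n *: Pp + S (- beta) n *: Pm.
  have -> : (('i%C * beta%:C%C) ^+ n / (n`!)%:R) *: iter n (@Gamma R 2) F y =
     S beta n *: J ^+ n.
    rewrite iterF JE -scalerN exprZn /S rmorphM rmorphXn fmorphV rmorph_nat.
    by rewrite !scalerA exprMn; congr (_ *: _); ring.
  rewrite Jpow scalerDr scalerA; congr (_ + _ *: _).
  rewrite /S (exprNn beta) -[(-1) ^+ n * _ / _]mulrA.
  rewrite [in RHS]rmorphM [in RHS]rmorphXn rmorphN rmorph1.
  by rewrite -[RHS]mulrA [RHS]mulrC.
have ca t := wave_jet_taylor a b t.
have := @cl_cvg (exp_iGamma_series beta F y)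
  (wave (a * cos beta + b * sin beta) *: Pp +
   wave (a * cos (- beta) + b * sin (- beta)) *: Pm).
case=> [A|cv lim].
  have := ccvgD (ccvgMr (Pp A) (ca beta)) (ccvgMr (Pm A) (ca (- beta))).
  rewrite !ffunE; congr ccvg; apply/funext => n.
  rewrite /exp_iGamma_series /series /=.
  under [in RHS]eq_bigr do rewrite termE.
  by rewrite big_split /= -!scaler_suml !ffunE.
split=> //.
rewrite /exp_iGamma lim PpE PmE involution_combE cosN sinN mulrN !waveD.
set d := b * sin beta; rewrite scalerDr !scalerA -mulrDr -mulrBr -!mulrA.
have -> : wave (- d) = (cos d +i* sin d)%C by rewrite /wave cosN sinN opprK.
have -> : wave d = (cos d +i* - sin d)%C by [].
have -> : ((cos d +i* - sin d)%C + (cos d +i* sin d)%C) / 2 = (cos d)%:C%C :> C.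
  have -> : ((cos d +i* - sin d)%C + (cos d +i* sin d)%C : C) =
      (cos d)%:C%C * 2.
    rewrite mulr_natr mulr2n; apply/eqP.
    by rewrite eq_complex /= addNr addr0 !eqxx.
  by rewrite mulfK // pnatr_eq0.
have -> : ((cos d +i* - sin d)%C - (cos d +i* sin d)%C) / 2 =
    - 'i%C * (sin d)%:C%C :> C.
  have -> : ((cos d +i* - sin d)%C - (cos d +i* sin d)%C : C) =
      - 'i%C * (sin d)%:C%C * 2.
    rewrite mulr_natr mulr2n; apply/eqP; rewrite eq_complex /=.
    by apply/andP; split; apply/eqP; ring.
  by rewrite mulfK // pnatr_eq0.
rewrite JE -[- ('i%C *: e12)]scaleNr -[- (_%:C%C *: e12)]scaleNr !scalerA.
congr (_ *: _ + _ *: _).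
by rewrite -!mulrA; congr (_ * _); rewrite mulrCA mulrNN -expr2 sqr_i mulrN1.
Qed.

(** The angular derivative of <x, .> at y; up to sign, the coefficient of the
wedge product of x and y. *)
Definition perp_dot x y : R := x 0 i1 * y 0 i0 - x 0 i0 * y 0 i1.

Lemma dotpE x y : dotp x y = x 0 i0 * y 0 i0 + x 0 i1 * y 0 i1.
Proof. by rewrite /dotp !big_ord_recl big_ord0 addr0. Qed.

Lemma wedgeE x y : wedge x y = (- perp_dot x y)%:C%C *: e12.
Proof.
by rewrite /wedge big_ord2_lt; congr (_%:C%C *: _); rewrite /perp_dot; ring.
Qed.

Lemma cl_norm_wedge x y : cl_norm (wedge x y) = `|perp_dot x y|.
Proof.
rewrite /cl_norm (bigD1 [set: 'I_2]%SET) //= big1 => [|A /negbTE A1].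
  rewrite wedgeE ffunE e12E eqxx addr0 /= /GRing.scale /=.
  by rewrite !mulr1 !mulr0 subr0 add0r expr0n addr0 sqrtr_sqr normrN.
by rewrite wedgeE ffunE e12E A1 /GRing.scale /= !mulr0 subr0 addr0 expr0n addr0.
Qed.

Lemma enorm_sqr x : enorm x ^+ 2 = dotp x x.
Proof.
by rewrite sqr_sqrtr // dotpE addr_ge0 // -expr2 sqr_ge0.
Qed.

Lemma perp_dot_sqr x y :
  enorm x ^+ 2 * enorm y ^+ 2 - dotp x y ^+ 2 = perp_dot x y ^+ 2.
Proof. by rewrite !enorm_sqr !dotpE /perp_dot; ring. Qed.

Lemma iter_Gamma_plane_wave (alpha : R) x y n :
  iter n (@Gamma R 2) (plane_wave alpha x) y =
  wave_jet n (dotp x y / sin alpha) (perp_dot x y / sin alpha) *: (- e12) ^+ n.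
Proof.
elim: n y => [|n IH] y.
  by rewrite expr0 wave_jet0 /= /plane_wave cexp_Ni.
rewrite iterS (_ : iter n _ _ = fun y => wave_jet n (dotp x y / sin alpha)
  (perp_dot x y / sin alpha) *: (- e12) ^+ n); last exact/funext.
rewrite exprS; apply: Gamma_scale.
have dc j := has_diff_coord y (rot90 y) j.
have r0 : rot90 y 0 i0 = - y 0 i1 by rewrite !mxE /= mulr0 mulr1 sub0r.
have r1 : rot90 y 0 i1 = y 0 i0 by rewrite !mxE /= mulr0 mulr1 subr0.
have lin p q : has_diff y (rot90 y)
    (fun z : 'rV[R]_2 => (p * z 0 i0 + q * z 0 i1) / sin alpha)
    ((q * y 0 i0 - p * y 0 i1) / sin alpha).
  have dp := has_diffM (has_diff_cst _ _ p) (dc i0).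
  have dq := has_diffM (has_diff_cst _ _ q) (dc i1).
  apply: (has_diff_eq (has_diffM (has_diffD dp dq) (has_diff_cst _ _ _))).
  by rewrite r0 r1; ring.
apply: has_cdiff_wave_jet.
  by have := lin (x 0 i0) (x 0 i1); under eq_fun do rewrite -dotpE.
have := lin (x 0 i1) (- x 0 i0).
under eq_fun do rewrite mulNr -/(perp_dot x _).
by move=> H; apply: (has_diff_eq H); rewrite dotpE; ring.
Qed.

End Plane.

(** At w = 0 both sides vanish whatever the value of [sin_quot] is. *)
Lemma sin_quotM (R : realType) (k w : R) :
  w * sin_quot k `|w| = sin (w * k).
Proof.
rewrite /sin_quot; case: eqVneq => [/normr0P/eqP ->|w0].
  by rewrite !mul0r sin0.
have [wge|wlt] := leP 0 w.
  by rewrite (ger0_norm wge) in w0 *; rewrite mulrC divfK.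
rewrite (ltr0_norm wlt) in w0 *; rewrite mulNr sinN.
by field; rewrite -oppr_eq0.
Qed.

Theorem theorem4p1 (R : realType) (alpha beta : R)
    (halpha : - pi <= alpha <= pi) (hbeta : - pi <= beta <= pi)
    (halpha0 : alpha != 0) (halphapi : alpha != pi) (halphaNpi : alpha != - pi)
    (x y : 'rV[R]_2) :
  let t := cl_norm (wedge x y) in
  [/\ t = Num.sqrt (enorm x ^+ 2 * enorm y ^+ 2 - dotp x y ^+ 2),
      cl_is_cvg (exp_iGamma_series beta (plane_wave alpha x) y) &
      frac_CF_kernel alpha beta x y =
      ((cos (t * (sin beta / sin alpha)))%:C%C%:A
       + wedge x y * (sin_quot (sin beta / sin alpha) t)%:C%C%:A)
      * (cexp (- 'i%C * (dotp x y * (cos beta / sin alpha))%:C%C))%:A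
      * (cexp ('i%C * (cot alpha / 2 *
                 (enorm x ^+ 2 + enorm y ^+ 2))%:C%C))%:A].
Proof.
move=> t.
have [cv sumE] := exp_iGamma_series_cvg beta (iter_Gamma_plane_wave alpha x y).
have tE : t = `|perp_dot x y| by exact: cl_norm_wedge.
split=> //; first by rewrite perp_dot_sqr sqrtr_sqr.
rewrite /frac_CF_kernel sumE cexp_Ni -/(chirp alpha x y) tE wedgeE.
set k := sin beta / sin alpha; set w := perp_dot x y.
have -> : w / sin alpha * sin beta = w * k by rewrite /k; ring.
have -> : dotp x y / sin alpha * cos beta = dotp x y * (cos beta / sin alpha).
  by ring.
rewrite !mulr_algr (scalerA (sin_quot k `|w|)%:C%C) -rmorphM.
have -> : sin_quot k `|w| * - w = - sin (w * k) by rewrite -sin_quotM; ring.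
have -> : cos (`|w| * k) = cos (w * k).
  by case: (ger0P w) => // _; rewrite mulNr cosN.
by rewrite rmorphN scaleNr.
Qed.
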